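(* Let $R$ be a unital $*$-ring and let $a,b\in R$ be core invertible with $a^*b^{(\#)}=b^{(\#)}a^*$ and $bab=ab^2$. If $a\,b^{(\#)}=b^{(\#)}a$ and $a^{(\#)}b=b\,a^{(\#)}$, then $ab$ is core invertible and $(ab)^{(\#)}=a^{(\#)}b^{(\#)}=b^{(\#)}a^{(\#)}$.
   Context: A unital $*$-ring is an associative ring $R$ with unity $1$ equipped with an involution $*:R\to R$ satisfying $(a+b)^*=a^*+b^*$, $(ab)^*=b^*a^*$ and $(a^* )^*=a$ for all $a,b\in R$. An element $a\in R$ is core invertible if there exists $x\in R$ with $axa=a$, $xax=x$, $(ax)^*=ax$, $xa^2=a$ and $ax^2=x$; such an $x$ is unique when it exists, is called the core inverse of $a$, and is denoted $a^{(\#)}$. *)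

(* Defs.v *)
From HB Require Import structures.
From mathcomp Require Import all_boot ssralg.

Set Implicit Arguments.
Unset Strict Implicit.
Unset Printing Implicit Defensive.

Import GRing.Theory.
Local Open Scope ring_scope.

(* The base structure is pzRingType, so the zero ring is included. *)
HB.mixin Record isStarRing R of GRing.PzRing R := {
  star : R -> R;
  starD : {morph star : x y / x + y};
  starM : forall x y : R, star (x * y) = star y * star x;
  starK : involutive star
}.

#[short(type="starRingType")]
HB.structure Definition StarRing := {R of isStarRing R & GRing.PzRing R}.

Definition is_core_inverse (R : starRingType) (a x : R) : bool :=
  [&& a * x * a == a, x * a * x == x, star (a * x) == a * x,
      x * a ^+ 2 == a & a * x ^+ 2 == x].

Definition core_invertible (R : starRingType) (a : R) : Prop :=
  exists x : R, is_core_inverse a x.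

Definition core_inv (R : starRingType) (a : R) (ha : core_invertible a) : R :=
  xchoose ha.

Lemma core_invP (R : starRingType) (a : R) (ha : core_invertible a) :
  is_core_inverse a (core_inv ha).
Proof. exact: xchooseP. Qed.

Lemma is_core_inverse_uniq (R : starRingType) (a x y : R) :
  is_core_inverse a x -> is_core_inverse a y -> x = y.
Proof.
move=> /and5P[/eqP axa /eqP xax /eqP sx /eqP xa2 /eqP ax2].
move=> /and5P[/eqP aya /eqP yay /eqP sy /eqP ya2 /eqP ay2].
have exy : a * x = a * y.
  have e : a * x = a * y * (a * x) by rewrite mulrA aya.
  by rewrite -sx e starM sx sy mulrA axa.
have xay : x * (a * y) = y.
  have -> : x * (a * y) = x * a ^+ 2 * y ^+ 2 by rewrite -[in LHS]ay2 !expr2 !mulrA.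
  by rewrite xa2.
by rewrite -[LHS]xax -mulrA exy xay.
Qed.

(* Independence of the chosen witness, hence of the proof ha. *)
Lemma core_invE (R : starRingType) (a x : R) (ha : core_invertible a) :
  is_core_inverse a x -> core_inv ha = x.
Proof. exact: is_core_inverse_uniq (core_invP ha). Qed.

(* Main.v *)
Require Import Defs.
From HB Require Import structures.
From mathcomp Require Import all_boot ssralg.
Import GRing.Theory.
Local Open Scope ring_scope.

(** Write [x] and [y] for the core inverses of [a] and [b], and let [a * x] and
    [b * y] be the associated projections (self-adjoint idempotents).

    The element [y] commutes with [a], so it preserves the range of [a * x]; it
    commutes with [star a], so it preserves the kernel of [a * x]. Hence [y]
    commutes with the projection [a * x] itself, and then with [x]: this is
    [core_inverse_comm]. Multiplying [b * a * b = a * b ^+ 2] on the right by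
    [y ^+ 2] shows that [a] commutes with [b * y] ([comm_core_proj]).

    Although [a] and [b] need not commute, these relations suffice to compute
    [(a * b) * (x * y) = (a * x) * (b * y)], a product of two commuting
    projections, and to check each axiom of the core inverse for [x * y]
    ([is_core_inverseM]). *)

Lemma is_core_inverseP {R : starRingType} {a x : R} :
  is_core_inverse a x <->
  [/\ a * x * a = a, x * a * x = x, star (a * x) = a * x,
      x * a * a = a & a * x * x = x].
Proof.
rewrite /is_core_inverse !expr2 !mulrA.
by split=> [/and5P[] | []]; [do 5!move/eqP=> ? | do 5!move/eqP=> ->].
Qed.

(** The range of [a * x] is that of [a], which [y] preserves, so
    [a * x * y * (a * x) = y * (a * x)]; its kernel is that of [star a], which
    [y] also preserves, so [a * x * y * (a * x) = a * x * y]. *)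
Lemma core_proj_comm {R : starRingType} {a x y : R} :
    is_core_inverse a x -> GRing.comm a y -> GRing.comm (star a) y ->
  GRing.comm (a * x) y.
Proof.
move=> /is_core_inverseP[axa _ sax _ _] ay say.
have range_stable : a * x * y * (a * x) = y * (a * x).
  by rewrite !mulrA -(mulrA (a * x)) -ay !mulrA axa ay.
have sa_proj : star a * (a * x) = star a by rewrite -{1}sax -starM axa.
have kernel_stable : a * x * y * (a * x) = a * x * y.
  by rewrite -{1 3}sax starM -!(mulrA (star x)) say -mulrA sa_proj.
by rewrite /GRing.comm -kernel_stable.
Qed.

(** Commuting with the projection [a * x] turns [x * y = x * a * x * y] into
    [x * a * y * x]. The idempotent [x * a] fixes [a], hence also
    [y * x = a * y * x ^+ 2]. *)
Lemma core_inverse_comm {R : starRingType} {a x y : R} :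
    is_core_inverse a x -> GRing.comm a y -> GRing.comm (star a) y ->
  GRing.comm x y.
Proof.
move=> cax ay say; have py := core_proj_comm cax ay say.
move: cax => /is_core_inverseP[_ xax _ xaa axx].
have xa_fix : x * a * (y * x) = y * x.
  have -> : y * x = a * (y * x * x) by rewrite -{1}axx !mulrA ay.
  by rewrite !mulrA xaa.
rewrite /GRing.comm -{1}xax -!mulrA [a * _]mulrA py.
by rewrite [y * _]mulrA -ay -[RHS]xa_fix !mulrA.
Qed.

(** Since [b * y ^+ 2 = y], the factor [y ^+ 2] turns [b * a * b] into
    [b * a * y = b * y * a] and [a * b ^+ 2] into [a * (b * y)]. *)
Lemma comm_core_proj {R : starRingType} {a b y : R} :
    is_core_inverse b y -> GRing.comm a y -> b * a * b = a * b ^+ 2 ->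
  GRing.comm a (b * y).
Proof.
move=> /is_core_inverseP[_ _ _ _ byy] ay; rewrite expr2 => bab.
have : b * a * b * (y * y) = a * (b * b) * (y * y) by rewrite bab.
rewrite -!(mulrA _ b) [b * (y * y)]mulrA byy -!mulrA [b * (y * y)]mulrA byy.
by rewrite ay /GRing.comm -mulrA => ->.
Qed.

Lemma is_core_inverseM {R : starRingType} {a b x y : R} :
    is_core_inverse a x -> is_core_inverse b y ->
    b * a * b = a * b ^+ 2 ->
    GRing.comm a y -> GRing.comm x b -> GRing.comm x y ->
  is_core_inverse (a * b) (x * y).
Proof.
move=> cax cby bab ay xb xy.
have aq := comm_core_proj cby ay bab.
move: cax cby => /is_core_inverseP[axa xax sax xaa axx].
move=> /is_core_inverseP[byb yby sby ybb byy].
have xq : GRing.comm x (b * y) by apply: commrM.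
have pq : GRing.comm (a * x) (b * y).
  by apply/commr_sym/commrM; apply: commr_sym.
have czE : a * b * (x * y) = a * x * (b * y).
  by rewrite !mulrA -(mulrA a b) -xb !mulrA.
apply/is_core_inverseP; rewrite czE; split.
- by rewrite pq mulrA -(mulrA _ (a * x)) axa -aq -mulrA byb.
- rewrite -[_ * (a * b) * _]mulrA czE mulrA -(mulrA x).
  have py : GRing.comm (a * x) y by apply/commr_sym/commrM; apply: commr_sym.
  by rewrite -py !mulrA xax -!(mulrA x) yby.
- by rewrite starM sax sby pq.
- (* [a] and [b] need not commute: [a] passes over [b] only in the factor
     [b * a * b], and [y] then passes over [a] to be absorbed by [b ^+ 2]. *)
  have -> : x * y * (a * b) * (a * b) = x * (y * a) * (b * a * b).
    by rewrite !mulrA.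
  rewrite bab expr2 -ay.
  have -> : x * (a * y) * (a * (b * b)) = x * a * (y * a) * (b * b).
    by rewrite !mulrA.
  by rewrite -ay !mulrA xaa -!mulrA [y * _]mulrA ybb.
- by rewrite mulrA -(mulrA (a * x)) -xq mulrA axx -mulrA byy.
Qed.

Theorem theorem3p5 (R : starRingType) (a b : R)
  (ha : core_invertible a) (hb : core_invertible b)
  (h1 : star a * core_inv hb = core_inv hb * star a)
  (h2 : b * a * b = a * b ^+ 2)
  (h3 : a * core_inv hb = core_inv hb * a)
  (h4 : core_inv ha * b = b * core_inv ha) :
  exists hab : core_invertible (a * b),
    core_inv hab = core_inv ha * core_inv hb /\
    core_inv ha * core_inv hb = core_inv hb * core_inv ha.
Proof.
have cax := core_invP ha; have cby := core_invP hb.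
have xy := core_inverse_comm cax h3 h1.
have cab := is_core_inverseM cax cby h2 h3 h4 xy.
exists (ex_intro (is_core_inverse (a * b)) _ cab); split=> //.
exact: core_invE cab.
Qed.
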